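(* Consider the algorithm described in the context, and suppose it does not terminate finitely. Then there exists a subsequence of iterations $\mathcal K\subseteq\mathbb{N}$ such that $\lim_{k\in\mathcal K}J_k^Tc_k=0$.
   Context: Problem: $\min_{x\in\mathbb{R}^n} f(x)+r(x)$ subject to $c(x)=0$, where $f:\mathbb{R}^n\to\mathbb{R}$ and $c:\mathbb{R}^n\to\mathbb{R}^m$ ($m\le n$) are continuously differentiable and $r:\mathbb{R}^n\to\mathbb{R}_{\ge 0}$ is convex. Write $g(x)=\nabla f(x)$, $J(x)=\nabla c(x)^T$, and $f_k=f(x_k)$, $g_k=g(x_k)$, $c_k=c(x_k)$, $J_k=J(x_k)$, $r_k=r(x_k)$. All norms are Euclidean. Merit function: $\Phi_\tau(x)=\tau(f(x)+r(x))+\|c(x)\|_2$. Algorithm: inputs $x_0$, $\alpha_0>0$, $\tau_{-1}>0$; constants $\kappa_v>0$, $\sigma_c,\epsilon_\tau,\xi,\eta\in(0,1)$, $\sigma_u\in(0,1/2]$, $\bar\sigma_u:=\sigma_u+\tfrac12$. For $k=0,1,\dots$: 1. If $J_k^Tc_k\ne0$, compute $v_k$ with $v_k\in\mathrm{Range}(J_k^T)$, $\|v_k\|_2\le\kappa_v\alpha_k\|J_k^Tc_k\|_2$, $\|c_k+J_kv_k\|_2\le\|c_k+J_kv_k^c\|_2$, where $v_k^c=-\beta_k^cJ_k^Tc_k$ with $\beta_k^c$ minimizing $\tfrac12\|c_k-\beta J_kJ_k^Tc_k\|_2^2$ over $0\le\beta\le\kappa_v\alpha_k$. Otherwise set $v_k=0$,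 and if $c_k\ne0$ terminate. 2. Let $u_k$ be the unique minimizer of $g_k^Tu+\tfrac1{2\alpha_k}\|u\|_2^2+r(x_k+v_k+u)$ subject to $J_ku=0$; set $s_k=v_k+u_k$. If $s_k=0$, terminate. 3. Let $D_k:=g_k^Ts_k+\bar\sigma_u\|s_k\|_2^2/\alpha_k+r(x_k+s_k)-r_k$; $\tau_{k,\mathrm{trial}}=\infty$ if $D_k\le0$, else $\tau_{k,\mathrm{trial}}=(1-\sigma_c)(\|c_k\|_2-\|c_k+J_kv_k\|_2)/D_k$. Set $\tau_k=\tau_{k-1}$ if $\tau_{k-1}\le\tau_{k,\mathrm{trial}}$, else $\tau_k=\min\{(1-\epsilon_\tau)\tau_{k-1},\tau_{k,\mathrm{trial}}\}$. 4. With $\Delta q_k(s,\tau):=-\tau(g_k^Ts+\tfrac1{2\alpha_k}\|s\|_2^2+r(x_k+s)-r_k)+\|c_k\|_2-\|c_k+J_ks\|_2$: if $\Phi_{\tau_k}(x_k+s_k)\le\Phi_{\tau_k}(x_k)-\eta\Delta q_k(s_k,\tau_k)$ set $x_{k+1}=x_k+s_k$, $\alpha_{k+1}=\alpha_k$; else $x_{k+1}=x_k$, $\alpha_{k+1}=\xi\alpha_k$. Assumption: there is an open convex set $\mathcal X$ containing all iterates $x_k$ and trial points $x_k+s_k$ such that $f$ is bounded below on $\mathcal X$, $\nabla f$ is bounded and Lipschitz continuous on $\mathcal X$, $c$ is bounded on $\mathcal X$, $J$ is bounded and Lipschitz continuous on $\mathcal X$, and all subgradients of $r$ at points of $\mathcal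 X$ are uniformly bounded in norm. *)

(* Defs.v *)
From HB Require Import structures.
From mathcomp Require Import all_boot all_order all_algebra.
From mathcomp Require Import all_classical all_reals all_analysis.
Set Implicit Arguments. Unset Strict Implicit. Unset Printing Implicit Defensive.
Import Order.TTheory GRing.Theory Num.Theory.
Import numFieldNormedType.Exports.
Local Open Scope ring_scope.
Local Open Scope classical_set_scope.

Definition dotv {R : realType} {k : nat} (u v : 'cV[R]_k) : R :=
  \sum_(i < k) u i ord0 * v i ord0.

Definition enorm {R : realType} {k : nat} (v : 'cV[R]_k) : R :=
  Num.sqrt (\sum_(i < k) (v i ord0) ^+ 2).

Definition convex_set_cV {R : realType} {n : nat} (X : set 'cV[R]_n) : Prop :=
  forall x y t, X x -> X y -> 0 <= t <= 1 -> X ((1 - t) *: x + t *: y).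

Definition convex_fun_cV {R : realType} {n : nat} (r : 'cV[R]_n -> R) : Prop :=
  forall x y t, 0 <= t <= 1 ->
    r ((1 - t) *: x + t *: y) <= (1 - t) * r x + t * r y.

Definition is_subgradient {R : realType} {n : nat} (r : 'cV[R]_n -> R)
  (x z : 'cV[R]_n) : Prop :=
  forall y, r x + dotv z (y - x) <= r y.

Definition merit {R : realType} {n m : nat} (f r : 'cV[R]_n -> R)
  (c : 'cV[R]_n -> 'cV[R]_m) (tau : R) (x : 'cV[R]_n) : R :=
  tau * (f x + r x) + enorm (c x).

Definition model_red {R : realType} {n m : nat} (r : 'cV[R]_n -> R)
  (gk : 'cV[R]_n) (ck : 'cV[R]_m) (Jk : 'M[R]_(m, n)) (xk : 'cV[R]_n)
  (alphak : R) (s : 'cV[R]_n) (tau : R) : R :=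
  - tau * (dotv gk s + (2 * alphak)^-1 * enorm s ^+ 2 + r (xk + s) - r xk)
  + enorm ck - enorm (ck + Jk *m s).

Definition prev_tau {R : realType} (tau_m1 : R) (tau : nat -> R) (k : nat) : R :=
  match k with O => tau_m1 | k'.+1 => tau k' end.

(* Main.v *)
(* Suppose |J_k^T c_k| >= eps for all large k.  The Cauchy step makes the linearized
   constraint violation drop by at least a multiple of alpha_k |J_k^T c_k|^2, whereas
   the optimality of u_k bounds D_k by a multiple of alpha_k |J_k^T c_k|; hence tau_k is
   bounded away from 0.  Taylor expansion then shows that every sufficiently small step
   is accepted, so alpha_k is bounded away from 0 too.  Consequently
     tau_k (f(x_k) - inf f + r(x_k)) + |c(x_k)| + alpha_k,
   which is nonnegative, decreases by a fixed amount at every iteration, accepted (through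
   the merit function, tau_k being nonincreasing) or rejected (through alpha_k). *)
Require Import Defs.
From HB Require Import structures.
From mathcomp Require Import all_boot all_order all_algebra.
From mathcomp Require Import all_classical all_reals all_analysis.
From mathcomp Require Import ring lra.
Import Order.TTheory GRing.Theory Num.Theory.
Import numFieldNormedType.Exports.
Local Open Scope ring_scope.
Local Open Scope classical_set_scope.

(** * Inner product and Euclidean norm *)

Section Euclidean.
Set Implicit Arguments. Unset Strict Implicit. Unset Printing Implicit Defensive.
Context {R : realType}.

Lemma dotvC k (a b : 'cV[R]_k) : dotv a b = dotv b a.
Proof. by apply: eq_bigr => i _; rewrite mulrC. Qed.

Lemma dotvDl k (a b w : 'cV[R]_k) : dotv (a + b) w = dotv a w + dotv b w.
Proof. by rewrite -big_split; apply: eq_bigr => i _; rewrite mxE mulrDl. Qed.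

Lemma dotvZl k t (a w : 'cV[R]_k) : dotv (t *: a) w = t * dotv a w.
Proof. by rewrite /dotv big_distrr /=; apply: eq_bigr => i _; rewrite mxE mulrA. Qed.

Lemma dotvDr k (a b w : 'cV[R]_k) : dotv w (a + b) = dotv w a + dotv w b.
Proof. by rewrite dotvC dotvDl !(dotvC _ w). Qed.

Lemma dotvZr k t (a w : 'cV[R]_k) : dotv w (t *: a) = t * dotv w a.
Proof. by rewrite dotvC dotvZl dotvC. Qed.

Lemma dotvNl k (a w : 'cV[R]_k) : dotv (- a) w = - dotv a w.
Proof. by rewrite -scaleN1r dotvZl mulN1r. Qed.

Lemma dotvNr k (a w : 'cV[R]_k) : dotv w (- a) = - dotv w a.
Proof. by rewrite dotvC dotvNl dotvC. Qed.

Lemma dotv0 k (w : 'cV[R]_k) : dotv w 0 = 0.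
Proof. by rewrite -(scale0r 0) dotvZr mul0r. Qed.

Lemma dotv_trmx_mul k l (A : 'M[R]_(k, l)) (a : 'cV_k) (b : 'cV_l) :
  dotv (A^T *m a) b = dotv a (A *m b).
Proof.
transitivity (\sum_i \sum_j A j i * a j ord0 * b i ord0).
  by apply: eq_bigr => i _; rewrite mxE big_distrl /=; apply: eq_bigr => j _; rewrite mxE.
rewrite exchange_big; apply: eq_bigr => j _; rewrite mxE big_distrr /=.
by apply: eq_bigr => i _ /=; ring.
Qed.

Lemma enorm_ge0 k (a : 'cV[R]_k) : 0 <= enorm a.
Proof. exact: sqrtr_ge0. Qed.

Lemma sqr_enorm k (a : 'cV[R]_k) : enorm a ^+ 2 = dotv a a.
Proof.
by rewrite sqr_sqrtr; [apply: eq_bigr => i _|apply: sumr_ge0 => i _; apply: sqr_ge0].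
Qed.

Lemma entry_le_enorm k (a : 'cV[R]_k) i : `|a i ord0| <= enorm a.
Proof.
rewrite -sqrtr_sqr ler_wsqrtr// (bigD1 i)//= lerDl.
by apply: sumr_ge0 => j _; apply: sqr_ge0.
Qed.

Lemma enorm_eq0 k (a : 'cV[R]_k) : (enorm a == 0) = (a == 0).
Proof.
apply/eqP/eqP => [a0|->]; last first.
  by rewrite /enorm big1 ?sqrtr0// => i _; rewrite mxE expr0n.
apply/colP => i; rewrite mxE; apply/eqP.
by rewrite -normr_eq0 eq_le normr_ge0 andbT -a0 entry_le_enorm.
Qed.

Lemma enorm0 k : enorm (0 : 'cV[R]_k) = 0.
Proof. by apply/eqP; rewrite enorm_eq0. Qed.

Lemma enorm_gt0 k (a : 'cV[R]_k) : (0 < enorm a) = (a != 0).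
Proof. by rewrite lt_def enorm_eq0 enorm_ge0 andbT. Qed.

Lemma enormZ k t (a : 'cV[R]_k) : enorm (t *: a) = `|t| * enorm a.
Proof.
apply/eqP; rewrite -(@eqrXn2 _ 2)// ?mulr_ge0 ?enorm_ge0//.
by rewrite exprMn !sqr_enorm dotvZl dotvZr real_normK ?num_real//; apply/eqP; ring.
Qed.

Lemma enormN k (a : 'cV[R]_k) : enorm (- a) = enorm a.
Proof. by rewrite -scaleN1r enormZ normrN1 mul1r. Qed.

Lemma sqr_enormD k (a b : 'cV[R]_k) :
  enorm (a + b) ^+ 2 = enorm a ^+ 2 + 2 * dotv a b + enorm b ^+ 2.
Proof. by rewrite !sqr_enorm !dotvDl !dotvDr (dotvC b); ring. Qed.

(** Cauchy-Schwarz: the squared norm of |b| a - |a| b is 2|a||b| (|a||b| - <a,b>), and the positive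
    factor is divided out. *)
Lemma dotv_le_enorm k (a b : 'cV[R]_k) : dotv a b <= enorm a * enorm b.
Proof.
have [->|a0] := eqVneq a 0; first by rewrite dotvC dotv0 mulr_ge0 ?enorm_ge0.
have [->|b0] := eqVneq b 0; first by rewrite dotv0 mulr_ge0 ?enorm_ge0.
have := sqr_ge0 (enorm (enorm b *: a + (- enorm a) *: b)).
rewrite sqr_enormD !enormZ dotvZl dotvZr normrN !ger0_norm ?enorm_ge0//.
have : 0 < enorm a * enorm b by rewrite mulr_gt0 ?enorm_gt0.
move: (enorm a) (enorm b) (dotv a b) => p q d; nra.
Qed.

Lemma enormD k (a b : 'cV[R]_k) : enorm (a + b) <= enorm a + enorm b.
Proof.
rewrite -(@ler_pXn2r _ 2)// ?nnegrE ?addr_ge0 ?enorm_ge0// sqr_enormD.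
have := dotv_le_enorm a b; nra.
Qed.

End Euclidean.

(** * Subgradients of convex functions *)

Section Subgradient.
Set Implicit Arguments. Unset Strict Implicit. Unset Printing Implicit Defensive.
Context {R : realType}.

(** With weights t/(s+t) and s/(s+t) the multiples of [e] cancel, so convexity bounds [q] at a point
    of the segment from [h] to [h'], where [w] minorizes it. *)
Lemma convex_fun_cV_slopes n (q : 'cV[R]_n -> R) (w h h' e : 'cV[R]_n) (s t : R) :
  convex_fun_cV q -> (forall a : R, 0 <= a <= 1 ->
    dotv w ((1 - a) *: h + a *: h') <= q ((1 - a) *: h + a *: h')) ->
  0 < s -> 0 < t ->
  (dotv w h - q (h - s *: e)) / s <= (q (h' + t *: e) - dotv w h') / t.
Proof.
move=> qconv wq s0 t0; have st0 : 0 < s + t by rewrite addr_gt0.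
pose a := s / (s + t).
have a1 : 1 - a = t / (s + t) by rewrite /a; field; rewrite gt_eqF.
have a01 : 0 <= a <= 1.
  by rewrite /a ler_pdivrMr// mul1r lerDl divr_ge0 ltW.
have := qconv (h - s *: e) (h' + t *: e) a a01.
have -> : (1 - a) *: (h - s *: e) + a *: (h' + t *: e) = (1 - a) *: h + a *: h'.
  rewrite !scalerDr scalerN !scalerA a1 addrACA.
  rewrite (_ : - _ + _ = 0) ?addr0// /a.
  by rewrite -scaleNr -scalerDl (_ : _ + _ = 0) ?scale0r//; field; rewrite gt_eqF.
move=> /(le_trans (wq a a01)); rewrite dotvDr !dotvZr a1 /a.
move: (dotv w h) (dotv w h') (q _) (q _) => A B D C H.
rewrite ler_pdivrMr// mulrAC ler_pdivlMr//.
have : 0 <= (s + t) * (t / (s + t) * C + s / (s + t) * D - (t / (s + t) * A + s / (s + t) * B)).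
  by rewrite mulr_ge0 ?subr_ge0// ltW.
have -> : (s + t) * (t / (s + t) * C + s / (s + t) * D - (t / (s + t) * A + s / (s + t) * B)) = t * C + s * D - t * A - s * B.
  by field; rewrite gt_eqF.
lra.
Qed.

(* Hahn-Banach one coordinate at a time: the coefficient on the new coordinate is the
   supremum of the backward difference quotients, which lie below the forward ones. *)
Lemma convex_fun_cV_minorant n (q : 'cV[R]_n -> R) (j : nat) :
  convex_fun_cV q -> q 0 = 0 -> (j <= n)%N ->
  exists w, forall h : 'cV[R]_n,
    (forall i : 'I_n, (j <= i)%N -> h i ord0 = 0) -> dotv w h <= q h.
Proof.
move=> qconv q0; elim: j => [_|j IH jn].
  exists 0 => h h0; have -> : h = 0 by apply/colP => i; rewrite h0// mxE.
  by rewrite dotv0 q0.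
have [w wq] := IH (ltnW jn).
pose supp (h : 'cV[R]_n) := forall i : 'I_n, (j <= i)%N -> h i ord0 = 0.
pose e : 'cV[R]_n := delta_mx (Ordinal jn) ord0.
have slopes h h' s t : supp h -> supp h' -> 0 < s -> 0 < t ->
    (dotv w h - q (h - s *: e)) / s <= (q (h' + t *: e) - dotv w h') / t.
  move=> sh sh'; apply: convex_fun_cV_slopes => // a _; apply: wq => i ji.
  by rewrite !mxE sh// sh'// !mulr0 addr0.
have supp0 : supp 0 by move=> i _; rewrite mxE.
pose A : set R := [set z | exists h s,
  [/\ supp h, 0 < s & z = (dotv w h - q (h - s *: e)) / s]].
have Aub h t : supp h -> 0 < t -> ubound A ((q (h + t *: e) - dotv w h) / t).
  by move=> sh t0 _ [h' [s [sh' s0 ->]]]; apply: slopes.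
have Asup : has_sup A.
  split; first by exists ((dotv w 0 - q (0 - 1 *: e)) / 1), 0, 1.
  by exists ((q (0 + 1 *: e) - dotv w 0) / 1); apply: Aub.
have dote b (h : 'cV[R]_n) : dotv (b *: e) h = b * h (Ordinal jn) ord0.
  rewrite dotvZl; congr (_ * _); rewrite /dotv (bigD1 (Ordinal jn))//= big1.
    by rewrite mxE !eqxx mul1r addr0.
  by move=> i ij; rewrite mxE (negPf ij) mul0r.
(* The induction hypothesis does not constrain coordinate [j] of [w]; it is replaced by [sup A]. *)
exists (w + (sup A - w (Ordinal jn) ord0) *: e) => h hj.
set t := h (Ordinal jn) ord0; pose h' := h - t *: e.
have sh' : supp h'.
  move=> i; rewrite leq_eqVlt => /orP[/eqP ji|ji].
    have -> : i = Ordinal jn by apply: val_inj.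
    by rewrite !mxE !eqxx mulr1 subrr.
  rewrite !mxE hj// (_ : (i == _) = false) ?mulr0 ?subr0//.
  by apply/negbTE; rewrite -val_eqE /= gtn_eqF.
have hE : h = h' + t *: e by rewrite subrK.
have -> : dotv (w + (sup A - w (Ordinal jn) ord0) *: e) h = dotv w h' + t * sup A.
  rewrite dotvDl dote -/t [in dotv w h]hE dotvDr (dotvC w (t *: e)) dote; ring.
have [t0|t0|t0] := ltgtP t 0.
- have : A ((dotv w h' - q (h' - (- t) *: e)) / (- t)).
    by exists h', (- t); rewrite oppr_gt0.
  move=> /(ub_le_sup Asup.2); rewrite scaleNr opprK -hE ler_pdivrMr ?oppr_gt0//.
  lra.
- have := ge_sup Asup.1 (Aub h' t sh' t0).
  rewrite -hE ler_pdivlMr//; lra.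
- rewrite t0 mul0r addr0 hE t0 scale0r addr0; exact: wq.
Qed.

Lemma subgradient_exists n (r : 'cV[R]_n -> R) x :
  convex_fun_cV r -> exists z, is_subgradient r x z.
Proof.
move=> rconv; pose q h := r (x + h) - r x.
have qconv : convex_fun_cV q.
  move=> a b t t01; rewrite /q.
  have -> : x + ((1 - t) *: a + t *: b) = (1 - t) *: (x + a) + t *: (x + b).
    by rewrite !scalerDr addrACA -scalerDl subrK scale1r.
  have := rconv (x + a) (x + b) t t01; lra.
have q0 : q 0 = 0 by rewrite /q addr0 subrr.
have [z zq] := convex_fun_cV_minorant qconv q0 (leqnn n).
exists z => y; have := zq (y - x).
rewrite /q addrCA subrr addr0 => zy.
rewrite addrC -lerBrDr zy// => i; by rewrite leqNgt ltn_ord.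
Qed.

(** A subgradient at [y], tested at [p], bounds [r y - r p] from above, so only [y] has to lie in
    [X]. *)
Lemma convex_fun_cV_lipschitz n (r : 'cV[R]_n -> R) (X : set 'cV[R]_n) B :
  convex_fun_cV r -> (forall z w, X z -> is_subgradient r z w -> enorm w <= B) ->
  forall y p, X y -> r y - r p <= B * enorm (y - p).
Proof.
move=> rconv rB y p Xy; have [w wy] := subgradient_exists y rconv.
have /(ler_wpM2r (enorm_ge0 (y - p))) wB := rB _ _ Xy wy.
have := wy p; rewrite -opprB dotvNr.
have := dotv_le_enorm w (y - p); lra.
Qed.

End Subgradient.

(** * Taylor bounds along segments *)

Section Descent.
Set Implicit Arguments. Unset Strict Implicit. Unset Printing Implicit Defensive.
Context {R : realType}.

Lemma is_derive_line n (F : 'cV[R]_n -> R) (y s : 'cV[R]_n) (t df : R) :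
  is_derive (y + t *: s) s F df -> is_derive t 1 (fun a : R => F (y + a *: s)) df.
Proof.
case=> Fd <-.
have E : (fun h : R => h^-1 *: (((fun a : R => F (y + a *: s)) \o shift t) (h *: 1) -
      F (y + t *: s))) =
    (fun h : R => h^-1 *: ((F \o shift (y + t *: s)) (h *: s) - F (y + t *: s))).
  apply/funext => h /=; congr (_ *: (F _ - _)).
  by rewrite [h *: 1]mulr1 scalerDl addrCA.
by split; [rewrite /derivable E|rewrite /derive E].
Qed.

(** Mean value theorem for [h] minus the quadratic dh(0) t + L t^2/2; this difference has
    nonpositive derivative on [0, 1]. *)
Lemma descent_line (h dh : R -> R) (L : R) :
  (forall t : R, is_derive t 1 h (dh t)) ->
  (forall t : R, 0 <= t <= 1 -> dh t - dh 0 <= L * t) ->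
  h 1 <= h 0 + dh 0 + L / 2.
Proof.
move=> hd dhL.
pose k : R -> R := h - (dh 0 \*: id + (L / 2) \*: (@GRing.exp (R -> R) id 2)).
have kd (t : R) : is_derive t 1 k (dh t - (dh 0 + L * t)).
  apply: is_derive_eq; rewrite /GRing.scale /=; lra.
have [|z z01] := @MVT R k (fun t => dh t - (dh 0 + L * t)) 0 1 (@ltr01 R).
  apply: continuous_subspaceT => t; apply: differentiable_continuous.
  by apply/derivable1_diffP; case: (kd t).
have /dhL : 0 <= z <= 1 by rewrite !(itvP z01).
have kE t : k t = h t - (dh 0 * t + L / 2 * t ^+ 2) by [].
rewrite !kE; lra.
Qed.

Lemma smooth_upper_bound n (f : 'cV[R]_n -> R) (g : 'cV[R]_n -> 'cV[R]_n)
    (X : set 'cV[R]_n) (L : R) (y s : 'cV[R]_n) :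
  (forall z, differentiable f z) -> (forall z h, 'd f z h = dotv (g z) h) ->
  convex_set_cV X ->
  (forall z w, X z -> X w -> enorm (g z - g w) <= L * enorm (z - w)) ->
  X y -> X (y + s) ->
  f (y + s) <= f y + dotv (g y) s + L / 2 * enorm s ^+ 2.
Proof.
move=> fd fg Xconv gL Xy Xys.
have hd (t : R) : is_derive t 1 (fun a : R => f (y + a *: s)) (dotv (g (y + t *: s)) s).
  apply: is_derive_line; split; first exact: diff_derivable.
  by rewrite deriveE// fg.
have := @descent_line _ _ (L * enorm s ^+ 2) hd.
rewrite /= scale1r scale0r addr0 mulrAC; apply => t /andP[t0 t1].
have Xt : X (y + t *: s).
  have := Xconv _ _ t Xy Xys; rewrite t0 t1 => /(_ isT).
  by rewrite scalerDr addrA -scalerDl subrK scale1r.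
rewrite -dotvNl -dotvDl (le_trans (dotv_le_enorm _ _))//.
have := gL _ _ Xt Xy; rewrite [_ + _ - y]addrAC subrr add0r enormZ ger0_norm//.
move=> /(ler_wpM2r (enorm_ge0 s)) /le_trans; apply; rewrite le_eqVlt; apply/orP; left.
by apply/eqP; ring.
Qed.

(** The mean value theorem is scalar, so the remainder [w] is paired with itself: the function <w,
    c(y + a s)> yields |w|^2 <= |w| L|s|^2/2, and |w| cancels. *)
Lemma jacobian_taylor_bound n m (c : 'cV[R]_n -> 'cV[R]_m) (J : 'cV[R]_n -> 'M[R]_(m, n))
    (X : set 'cV[R]_n) (L : R) (y s : 'cV[R]_n) :
  (forall z, differentiable c z) -> (forall z h, 'd c z h = J z *m h) ->
  convex_set_cV X ->
  (forall z w h, X z -> X w -> enorm ((J z - J w) *m h) <= L * enorm (z - w) * enorm h) ->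
  X y -> X (y + s) ->
  enorm (c (y + s)) <= enorm (c y + J y *m s) + L / 2 * enorm s ^+ 2.
Proof.
move=> cd cJ Xconv JL Xy Xys.
set w := c (y + s) - (c y + J y *m s).
suff wb : enorm w ^+ 2 <= enorm w * (L / 2 * enorm s ^+ 2).
  rewrite -[c (y + s)](subrK (c y + J y *m s)) -/w addrC.
  rewrite (le_trans (enormD _ _))// lerD2l.
  (* If |w| = 0 nothing cancels and the sign of [L] is not given; the Lipschitz bound at the
     endpoints, applied to [s], shows 0 <= L|s|^2. *)
  have [->|w0] := eqVneq (enorm w) 0; last first.
    by move: wb; rewrite expr2 ler_pM2l// lt_def w0 enorm_ge0.
  have := JL _ _ s Xys Xy; rewrite [_ + _ - y]addrAC subrr add0r.
  have := enorm_ge0 ((J (y + s) - J y) *m s); lra.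
have hd (t : R) : is_derive t 1 (fun a : R => dotv w (c (y + a *: s)))
    (dotv w (J (y + t *: s) *m s)).
  apply: (@is_derive_line _ (fun z => dotv w (c z))).
  have cs : derivable c (y + t *: s) s by exact: diff_derivable.
  rewrite -cJ -deriveE// derive_mx//.
  rewrite (_ : (fun z => _) = \sum_(i < m) (w i ord0 \*: (fun z => c z i ord0))); last first.
    by apply/funext => z; rewrite fct_sumE.
  rewrite /dotv (eq_bigr (fun i => w i ord0 *: 'D_s (fun z => c z i ord0) (y + t *: s))).
    apply: is_derive_sum => i; apply: is_deriveZ.
    by apply: derivableP; exact: (derivable_mxP c _ _).1.
  by move=> i _; rewrite [X in _ * X]mxE.
have := @descent_line _ _ (enorm w * (L * enorm s ^+ 2)) hd.
rewrite /= scale1r scale0r addr0 => H.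
rewrite sqr_enorm {2}/w dotvDr dotvNr dotvDr lerBlDl (le_trans (H _))//; last by lra.
move=> t /andP[t0 t1].
have Xt : X (y + t *: s).
  have := Xconv _ _ t Xy Xys; rewrite t0 t1 => /(_ isT).
  by rewrite scalerDr addrA -scalerDl subrK scale1r.
rewrite -dotvNr -dotvDr -mulmxBl (le_trans (dotv_le_enorm _ _))// -!mulrA.
rewrite ler_wpM2l ?enorm_ge0//.
have := JL _ _ s Xt Xy; rewrite [_ + _ - y]addrAC subrr add0r enormZ ger0_norm//.
by move=> /le_trans; apply; rewrite le_eqVlt; apply/orP; left; apply/eqP; ring.
Qed.

End Descent.

(** * Estimates for a single iteration *)

Section Step.
Set Implicit Arguments. Unset Strict Implicit. Unset Printing Implicit Defensive.
Context {R : realType}.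

Lemma enorm_trmx_le n m (A : 'M[R]_(m, n)) B (a : 'cV_m) :
  (forall h, enorm (A *m h) <= B * enorm h) -> 0 <= B ->
  enorm (A^T *m a) <= B * enorm a.
Proof.
move=> AB B0; have [->|Aa0] := eqVneq (A^T *m a) 0.
  by rewrite enorm0 mulr_ge0 ?enorm_ge0.
rewrite -(ler_pM2r (x := enorm (A^T *m a))) ?enorm_gt0// -expr2 sqr_enorm dotv_trmx_mul.
rewrite (le_trans (dotv_le_enorm _ _))// mulrAC mulrC ler_wpM2r ?enorm_ge0//.
Qed.

(** With d = A^T a and beta B^2 <= 1, |a - beta A d|^2 = |a|^2 - 2 beta |d|^2 + beta^2 |A d|^2 <=
    |a|^2 - beta |d|^2. The difference of squares is then factored, the sum of the two norms being
    at most 2 [Ba]. *)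
Lemma cauchy_decrease n m (A : 'M[R]_(m, n)) (a : 'cV_m) (v : 'cV_n) B Ba beta :
  (forall h, enorm (A *m h) <= B * enorm h) -> enorm a <= Ba ->
  0 <= beta -> beta * B ^+ 2 <= 1 ->
  enorm (a + A *m v) <= enorm (a - beta *: (A *m A^T *m a)) ->
  beta * enorm (A^T *m a) ^+ 2 <= 2 * Ba * (enorm a - enorm (a + A *m v)).
Proof.
move=> AB aB beta0 betaB; rewrite -mulmxA; set d := A^T *m a => vbeta.
have : enorm (a + A *m v) ^+ 2 <= enorm a ^+ 2 - beta * enorm d ^+ 2.
  apply: (@le_trans _ _ (enorm (a - beta *: (A *m d)) ^+ 2)).
    by rewrite ler_pXn2r ?nnegrE ?enorm_ge0.
  rewrite sqr_enormD dotvNr dotvZr enormN enormZ -dotv_trmx_mul -/d -sqr_enorm.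
  rewrite exprMn real_normK ?num_real//.
  have : enorm (A *m d) ^+ 2 <= B ^+ 2 * enorm d ^+ 2.
    rewrite -exprMn ler_pXn2r ?nnegrE ?enorm_ge0//.
    by rewrite (le_trans (enorm_ge0 _) (AB d)).
  move=> /(ler_wpM2l (sqr_ge0 beta)).
  have : beta * (beta * B ^+ 2) * enorm d ^+ 2 <= beta * enorm d ^+ 2.
    by rewrite ler_wpM2r ?sqr_ge0// ler_piMr.
  lra.
have := mulr_ge0 beta0 (sqr_ge0 (enorm d)); move: (beta * _) => b b0.
have := enorm_ge0 a; have := enorm_ge0 (a + A *m v); move: (enorm a) (enorm (a + A *m v)) aB => p q.
move=> pB q0 p0 qp.
have qlep : q <= p by rewrite -(@ler_pXn2r _ 2) ?nnegrE//; lra.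
nra.
Qed.

(* Only points of X may be used, which excludes x + v; so u is compared with (1 - t) u,
   where p - t u is the midpoint of p - 2 t (u + v), on the segment [p, x], and of
   p + 2 t v, in X for small t; then t tends to 0. *)
Lemma tangential_optimality n (g x v u : 'cV[R]_n) (r : 'cV[R]_n -> R) (X : set 'cV[R]_n) alpha B :
  convex_fun_cV r -> open X -> X (x + (v + u)) ->
  (forall y p, X y -> r y - r p <= B * enorm (y - p)) -> 0 < alpha ->
  (forall t, dotv g u + (2 * alpha)^-1 * enorm u ^+ 2 + r (x + v + u) <=
    dotv g (t *: u) + (2 * alpha)^-1 * enorm (t *: u) ^+ 2 + r (x + v + t *: u)) ->
  dotv g u + enorm u ^+ 2 / alpha <= r x - r (x + (v + u)) + B * enorm v.
Proof.
move=> rconv Xopen Xp rB alpha0; rewrite -addrA; set p := x + (v + u) in Xp * => uopt.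
have [d d0 dX] : exists2 d : R, 0 < d & forall t, 0 < t < d -> X (p + t *: v).
  have /nbhs_ballP[e /= e0 eX] := open_nbhs_nbhs (conj Xopen Xp).
  exists (e / (`|v| + 1)); first by rewrite divr_gt0// ltr_wpDl.
  move=> t /andP[t0 te]; apply: eX; rewrite -ball_normE /= opprD addrA subrr sub0r normrN.
  rewrite normrZ gtr0_norm// (@le_lt_trans _ _ (t * (`|v| + 1)))//.
    by rewrite ler_wpM2l ?(ltW t0)// lerDl.
  by rewrite -ltr_pdivlMr// ltr_wpDl.
have small t : 0 < t -> t < 2^-1 -> t < d / 2 ->
    dotv g u + enorm u ^+ 2 / alpha <=
    r x - r p + B * enorm v + t * (enorm u ^+ 2 / (2 * alpha)).
  move=> t0 t1 td.
  have h1 : r (p + (2 * t) *: v) - r p <= B * (2 * t * enorm v).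
    have := rB (p + (2 * t) *: v) p; rewrite [p + _ - p]addrAC subrr add0r enormZ gtr0_norm; last by lra.
    by apply; apply: dX; lra.
  have h2 : r (p - (2 * t) *: (v + u)) <= (1 - 2 * t) * r p + 2 * t * r x.
    have -> : p - (2 * t) *: (v + u) = (1 - 2 * t) *: p + (2 * t) *: x.
      by apply/colP => i; rewrite !mxE; ring.
    by apply: rconv; lra.
  have h3 : r (x + v + (1 - t) *: u) <=
      (1 - 2^-1) * r (p - (2 * t) *: (v + u)) + 2^-1 * r (p + (2 * t) *: v).
    have -> : x + v + (1 - t) *: u =
        (1 - 2^-1) *: (p - (2 * t) *: (v + u)) + 2^-1 *: (p + (2 * t) *: v).
      by apply/colP => i; rewrite !mxE; field.
    by apply: rconv; lra.
  have := uopt (1 - t); rewrite dotvZr enormZ ger0_norm; last by lra.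
  rewrite -addrA -/p => h4.
  rewrite -(ler_pM2l t0).
  have -> : enorm u ^+ 2 / alpha = 2 * ((2 * alpha)^-1 * enorm u ^+ 2).
    by field; rewrite gt_eqF.
  rewrite [enorm u ^+ 2 / _]mulrC; move: h4; rewrite exprMn.
  move: (2 * alpha)^-1 (enorm u ^+ 2) => z U; lra.
set U := enorm u ^+ 2 / (2 * alpha) in small.
have U0 : 0 <= U by rewrite divr_ge0 ?sqr_ge0//; lra.
apply/ler_addgt0Pr => e e0.
(* The first two bounds put [t] in the range of [small]; the third gives t U <= t (U + 1) <= e. *)
pose t := Num.min (Num.min 4^-1 (d / 4)) (e / (U + 1)).
have eU0 : 0 < e / (U + 1) by rewrite divr_gt0//; lra.
have t0 : 0 < t by rewrite !lt_min eU0 andbT; lra.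
have [t1 t2 t3] : [/\ t <= 4^-1, t <= d / 4 & t <= e / (U + 1)].
  by rewrite !ge_min !lexx !orbT.
rewrite (le_trans (small t t0 _ _)) ?lerD2l//; [lra|lra|].
rewrite (@le_trans _ _ (t * (U + 1)))//; first by nra.
by rewrite -ler_pdivlMr//; lra.
Qed.

(** For positive [D], [rho] is a lower bound on the trial value. When the parameter is cut, [tp]
    exceeds the trial value, so both entries of the minimum are at least (1 - eps_tau) rho. *)
Lemma merit_parameter_update (tp t D Delta sigma_c eps_tau rho : R) :
  0 < sigma_c < 1 -> 0 < eps_tau < 1 -> 0 < tp -> 0 <= Delta -> 0 <= rho ->
  rho * D <= (1 - sigma_c) * Delta -> (0 < D -> 0 < rho) ->
  (if D <= 0 then t = tp
   else let ttrial := (1 - sigma_c) * Delta / D in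
     t = if tp <= ttrial then tp else Num.min ((1 - eps_tau) * tp) ttrial) ->
  [/\ 0 < t, t <= tp, t * D <= (1 - sigma_c) * Delta
    & Num.min tp ((1 - eps_tau) * rho) <= t].
Proof.
move=> sc et tp0 Delta0 rho0 rhoD Drho.
have scD : 0 <= (1 - sigma_c) * Delta by rewrite mulr_ge0//; lra.
case: (leP D 0) => [D0 ->|D0 /=].
  split=> //; last by rewrite ge_min lexx.
  by rewrite (le_trans _ scD)// pmulr_rle0.
set tt := _ / D; have ttD : tt * D = (1 - sigma_c) * Delta by rewrite divfK// gt_eqF.
have rhott : rho <= tt by rewrite ler_pdivlMr.
have := Drho D0 => rhop.
have tt0 : 0 < tt := lt_le_trans rhop rhott.
case: (leP tp tt) => [tptt ->|tttp ->].
  split=> //; first by rewrite -ttD ler_pM2r.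
  by rewrite ge_min lexx.
split.
- by rewrite lt_min tt0 andbT mulr_gt0//; lra.
- by rewrite ge_min; apply/orP; left; nra.
- by rewrite -ttD ler_pM2r// ge_min lexx orbT.
- rewrite ge_min; apply/orP; right; rewrite le_min; apply/andP; split; nra.
Qed.

End Step.

(** * Extraction of a null subsequence; impossibility of uniform decrease *)

Section Sequences.
Set Implicit Arguments. Unset Strict Implicit. Unset Printing Implicit Defensive.
Context {R : realType}.

Lemma subsequence_cvg0 n (a : nat -> 'cV[R]_n) :
  (forall e K, 0 < e -> exists2 k, (K <= k)%N & enorm (a k) < e) ->
  exists phi : nat -> nat, (forall i j, (i < j)%N -> (phi i < phi j)%N) /\
    (fun i => a (phi i)) @ \oo --> (0 : 'cV[R]_n).
Proof.
move=> small.
have /choice[pick pickP] : forall Ki : nat * nat, exists k,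
    (Ki.1 <= k)%N /\ enorm (a k) < Ki.2.+1%:R^-1.
  by move=> [K i]; have [|k ? ?] := small i.+1%:R^-1 K; [rewrite invr_gt0|exists k].
(* Each choice starts beyond the previous index and has tolerance 1/(i + 1). *)
pose phi := fix phi i := if i is j.+1 then pick ((phi j).+1, i) else pick (0, 0)%N.
exists phi; split.
  apply: (@homo_ltn _ phi (fun i j => (i < j)%N) ltn_trans) => i.
  exact: (pickP ((phi i).+1, i.+1)).1.
have phi_small i : enorm (a (phi i)) < i.+1%:R^-1.
  by case: i => [|i]; exact: (pickP (_, _)).2.
apply/cvgr0Pnorm_lt => e e0.
near=> i; have : `|@harmonic R i| < e.
  by near: i; apply: cvgr0_norm_lt e0; exact: cvg_harmonic.
apply: le_lt_trans.
rewrite [leLHS]/Num.Def.normr /= mx_normrE bigmax_le// => -[j k] _ /=.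
rewrite (ord1 k) (le_trans (entry_le_enorm _ _))// (le_trans (ltW (phi_small i)))//.
by rewrite ger0_norm /harmonic.
Unshelve. all: by end_near. Qed.

Lemma no_uniform_decrease (E : nat -> R) (d : R) K : 0 < d ->
  (forall k, (K <= k)%N -> 0 <= E k) ->
  ~ (forall k, (K <= k)%N -> E k.+1 <= E k - d).
Proof.
move=> d0 E0 Ed.
have Ek j : E (K + j)%N <= E K - j%:R * d.
  elim: j => [|j IH]; first by rewrite addn0 mul0r subr0.
  rewrite addnS (le_trans (Ed _ _)) ?leq_addr// -natr1; lra.
have := archi_boundP (divr_ge0 (E0 _ (leqnn K)) (ltW d0)).
rewrite ltr_pdivrMr// => /lt_geF/negP; apply.
by have := E0 _ (leq_addr (Num.bound (E K / d)) K); have := Ek (Num.bound (E K / d)); lra.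
Qed.

End Sequences.

(** * Stationarity of the constraint violation along a subsequence *)

Theorem theorem3p10
  (R : realType) (n m : nat) (Hmn : (m <= n)%N)
  (* problem data *)
  (f : 'cV[R]_n -> R) (g : 'cV[R]_n -> 'cV[R]_n)
  (c : 'cV[R]_n -> 'cV[R]_m) (J : 'cV[R]_n -> 'M[R]_(m, n))
  (r : 'cV[R]_n -> R)
  (* f, c continuously differentiable, with g = grad f and J = Jacobian of c *)
  (Hf_diff : forall z, differentiable f z)
  (Hf_grad : forall z h, 'd f z h = dotv (g z) h)
  (Hg_cont : continuous g)
  (Hc_diff : forall z, differentiable c z)
  (Hc_jac : forall z h, 'd c z h = J z *m h)
  (HJ_cont : continuous J)
  (* r : R^n -> R_{>=0} convex *)
  (Hr_nonneg : forall z, 0 <= r z)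
  (Hr_conv : convex_fun_cV r)
  (* algorithm constants *)
  (kappa_v sigma_c eps_tau xi eta sigma_u : R)
  (Hkappa : 0 < kappa_v)
  (Hsigma_c : 0 < sigma_c < 1) (Heps_tau : 0 < eps_tau < 1)
  (Hxi : 0 < xi < 1) (Heta : 0 < eta < 1)
  (Hsigma_u : 0 < sigma_u <= 2^-1)
  (* iterates: x_k, alpha_k, tau_k (tau_m1 = tau_{-1}), v_k, u_k; s_k = v_k + u_k *)
  (x : nat -> 'cV[R]_n) (alpha : nat -> R)
  (tau_m1 : R) (tau : nat -> R)
  (v u : nat -> 'cV[R]_n)
  (Halpha0 : 0 < alpha 0%N) (Htau_m1 : 0 < tau_m1)
  (* Step 1, case J_k^T c_k <> 0 *)
  (Hstep1 : forall k,
     let Jk := J (x k) in let ck := c (x k) in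
     Jk^T *m ck != 0 ->
       (exists w : 'cV[R]_m, v k = Jk^T *m w)
       /\ enorm (v k) <= kappa_v * alpha k * enorm (Jk^T *m ck)
       /\ exists beta_c : R,
            0 <= beta_c <= kappa_v * alpha k
            /\ (forall beta, 0 <= beta <= kappa_v * alpha k ->
                  2^-1 * enorm (ck - beta *: (Jk *m Jk^T *m ck)) ^+ 2
                  >= 2^-1 * enorm (ck - beta_c *: (Jk *m Jk^T *m ck)) ^+ 2)
            /\ enorm (ck + Jk *m v k)
               <= enorm (ck + Jk *m (- beta_c *: (Jk^T *m ck))))
  (* Step 1, case J_k^T c_k = 0 *)
  (Hstep1_0 : forall k, (J (x k))^T *m c (x k) = 0 -> v k = 0)
  (* Step 2: u_k minimizes the subproblem over the null space of J_k *)
  (Hstep2 : forall k,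
     J (x k) *m u k = 0
     /\ forall w, J (x k) *m w = 0 ->
          dotv (g (x k)) (u k) + (2 * alpha k)^-1 * enorm (u k) ^+ 2
            + r (x k + v k + u k)
          <= dotv (g (x k)) w + (2 * alpha k)^-1 * enorm w ^+ 2
            + r (x k + v k + w))
  (* Step 3: merit parameter update *)
  (Hstep3 : forall k,
     let s := v k + u k in
     let D := dotv (g (x k)) s + (sigma_u + 2^-1) * enorm s ^+ 2 / alpha k
              + r (x k + s) - r (x k) in
     let tp := prev_tau tau_m1 tau k in
     if D <= 0 then tau k = tp
     else
       let ttrial := (1 - sigma_c) * (enorm (c (x k))
                       - enorm (c (x k) + J (x k) *m v k)) / D in
       tau k = if tp <= ttrial then tp
               else Num.min ((1 - eps_tau) * tp) ttrial)
  (* Step 4: acceptance test and step size update *)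
  (Hstep4 : forall k,
     let s := v k + u k in
     if merit f r c (tau k) (x k + s)
          <= merit f r c (tau k) (x k)
             - eta * model_red r (g (x k)) (c (x k)) (J (x k)) (x k) (alpha k) s (tau k)
     then x k.+1 = x k + s /\ alpha k.+1 = alpha k
     else x k.+1 = x k /\ alpha k.+1 = xi * alpha k)
  (* the algorithm does not terminate finitely *)
  (Hnoterm_c : forall k, (J (x k))^T *m c (x k) = 0 -> c (x k) = 0)
  (Hnoterm_s : forall k, v k + u k != 0)
  (* standing assumption *)
  (Hassump : exists X : set 'cV[R]_n,
     open X /\ convex_set_cV X
     /\ (forall k, X (x k) /\ X (x k + (v k + u k)))
     /\ (exists flow, forall z, X z -> flow <= f z)
     /\ (exists Bg, forall z, X z -> enorm (g z) <= Bg)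
     /\ (exists Lg, forall z y, X z -> X y -> enorm (g z - g y) <= Lg * enorm (z - y))
     /\ (exists Bc, forall z, X z -> enorm (c z) <= Bc)
     /\ (exists BJ, forall z h, X z -> enorm (J z *m h) <= BJ * enorm h)
     /\ (exists LJ, forall z y h, X z -> X y ->
           enorm ((J z - J y) *m h) <= LJ * enorm (z - y) * enorm h)
     /\ (exists Br, forall z w, X z -> is_subgradient r z w -> enorm w <= Br))
  : exists phi : nat -> nat,
      (forall i j, (i < j)%N -> (phi i < phi j)%N)
      /\ (fun i => (J (x (phi i)))^T *m c (x (phi i))) @ \oo --> (0 : 'cV[R]_n).

Proof.
have [X [Xopen [Xconv [Xx [[flow fX] [[Bg gX] [[Lg' gLip] [[Bc' cX] [[BJ' JX] [[LJ' JLip] [Br' rX]]]]]]]]]]] := Hassump.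
pose d k := enorm ((J (x k))^T *m c (x k)).
pose s k := v k + u k.
pose Delta k := enorm (c (x k)) - enorm (c (x k) + J (x k) *m v k).
pose D k := dotv (g (x k)) (s k) + (sigma_u + 2^-1) * enorm (s k) ^+ 2 / alpha k
  + r (x k + s k) - r (x k).
pose dq k := model_red r (g (x k)) (c (x k)) (J (x k)) (x k) (alpha k) (s k) (tau k).
have step4 k : if merit f r c (tau k) (x k + s k) <= merit f r c (tau k) (x k) - eta * dq k
    then x k.+1 = x k + s k /\ alpha k.+1 = alpha k
    else x k.+1 = x k /\ alpha k.+1 = xi * alpha k := Hstep4 k.
(* The constants of the standing assumption need not be positive. *)
pose Lg : R := `|Lg'|; pose LJ : R := `|LJ'|; pose Br : R := `|Br'|.
pose Bc : R := `|Bc'| + 1; pose BJ : R := `|BJ'| + 1.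
have Bc0 : 0 < Bc by rewrite ltr_wpDl.
have BJ0 : 0 < BJ by rewrite ltr_wpDl.
have Lg0 : 0 <= Lg := normr_ge0 _.
have LJ0 : 0 <= LJ := normr_ge0 _.
have cB k : enorm (c (x k)) <= Bc.
  by rewrite (le_trans (cX _ (Xx k).1))// (le_trans (ler_norm _))// lerDl.
have JB k h : enorm (J (x k) *m h) <= BJ * enorm h.
  rewrite (le_trans (JX _ h (Xx k).1))// ler_wpM2r ?enorm_ge0//.
  by rewrite (le_trans (ler_norm _))// lerDl.
have rLip y p : X y -> r y - r p <= Br * enorm (y - p).
  apply: convex_fun_cV_lipschitz => // z w Xz rzw.
  by rewrite (le_trans (rX _ _ Xz rzw))// ler_norm.
have gLip' z y : X z -> X y -> enorm (g z - g y) <= Lg * enorm (z - y).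
  move=> Xz Xy; rewrite (le_trans (gLip _ _ Xz Xy))// ler_wpM2r ?enorm_ge0//.
  exact: ler_norm.
have JLip' z y h : X z -> X y -> enorm ((J z - J y) *m h) <= LJ * enorm (z - y) * enorm h.
  move=> Xz Xy; rewrite (le_trans (JLip _ _ h Xz Xy))// -!mulrA.
  by rewrite ler_wpM2r ?ler_norm// mulr_ge0 ?enorm_ge0.

(* Step sizes, normal step and Cauchy decrease *)
have step_size k : 0 < alpha k <= alpha 0%N /\ alpha k.+1 <= alpha k.
  elim: k => [|k [/andP[a0 aK] aS]].
    rewrite Halpha0 lexx; split=> //; have := step4 0%N; case: ifP => _ [_ ->] //.
    by rewrite ler_piMl//; lra.
  have a1 : 0 < alpha k.+1.
    by have := step4 k; case: ifP => _ [_ ->] //; rewrite mulr_gt0//; lra.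
  rewrite a1 (le_trans aS)//; split=> //.
  have := step4 k.+1; case: ifP => _ [_ ->] //.
  by rewrite ler_piMl ?ltW//; lra.
have a_gt0 k : 0 < alpha k by have [/andP[]] := step_size k.
have dB k : d k <= BJ * Bc.
  rewrite (le_trans (enorm_trmx_le _ (JB k) (ltW BJ0)))//.
  by rewrite ler_wpM2l// ltW.
have v_range k : exists w, v k = (J (x k))^T *m w.
  have [/Hstep1_0 ->|/Hstep1[]//] := eqVneq ((J (x k))^T *m c (x k)) 0.
  by exists 0; rewrite mulmx0.
have vB k : enorm (v k) <= kappa_v * alpha k * d k.
  rewrite /d; have [d0|/Hstep1[_ []]//] := eqVneq ((J (x k))^T *m c (x k)) 0.
  by rewrite Hstep1_0// d0 !enorm0 mulr0.
have vu k : dotv (v k) (u k) = 0.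
  by have [w ->] := v_range k; rewrite dotv_trmx_mul (Hstep2 k).1 dotv0.
(* This makes [alpha k * kappa] an admissible Cauchy step length and, since alpha_k <= alpha_0,
   keeps its product with [BJ ^+ 2] at most 1. *)
pose kappa := Num.min kappa_v (BJ ^+ 2 * alpha 0%N)^-1.
have kappa_gt0 : 0 < kappa by rewrite lt_min Hkappa invr_gt0 mulr_gt0// exprn_gt0.
have DeltaB k : alpha k * kappa * d k ^+ 2 <= 2 * Bc * Delta k.
  rewrite /d /Delta.
  have [d0|/Hstep1[_ [_ [bc [bc0 [bcopt vbc]]]]]] := eqVneq ((J (x k))^T *m c (x k)) 0.
    by rewrite d0 Hstep1_0// enorm0 mulmx0 addr0 subrr expr0n/= !mulr0.
  have ak := a_gt0 k.
  have akk : alpha k * kappa <= kappa_v * alpha k.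
    by rewrite mulrC ler_pM2r// ge_min lexx.
  have ak0 : 0 <= alpha k * kappa by rewrite mulr_ge0// ltW.
  apply: (cauchy_decrease (JB k) (cB k) ak0).
    have [/andP[_ a1] _] := step_size k.
    rewrite -mulrA (@le_trans _ _ (alpha 0%N * (kappa * BJ ^+ 2)))//.
      by rewrite ler_wpM2r// mulr_ge0 ?sqr_ge0// ltW.
    rewrite mulrCA [alpha 0%N * _]mulrC -ler_pdivlMr.
      by rewrite div1r ge_min lexx orbT.
    by rewrite mulr_gt0// exprn_gt0.
  (* The minimizer [bc] does at least as well as the step length [alpha k * kappa]. *)
  rewrite (le_trans vbc)// -scalemxAr scaleNr mulmxA.
  have := bcopt (alpha k * kappa); rewrite ak0 akk => /(_ isT).
  by rewrite ler_pM2l ?invr_gt0// ler_pXn2r ?nnegrE ?enorm_ge0.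
clearbody kappa.
have Delta_ge0 k : 0 <= Delta k.
  have := DeltaB k.
  have : 0 <= alpha k * kappa * d k ^+ 2.
    by rewrite mulr_ge0 ?sqr_ge0// ltW// mulr_gt0.
  move=> h /(le_trans h); rewrite pmulr_rge0//; lra.

(* Bounds on [D] and on the merit parameter *)
pose M := `|Bg| + Br + kappa_v * (BJ * Bc) + 1.
have M0 : 0 < M.
  by rewrite ltr_wpDl// !addr_ge0 ?normr_ge0// ltW// !mulr_gt0.
(* Every term is reduced to a multiple of |v_k|: [M] adds the bounds on the gradient, on the
   subgradients and on |v_k|/alpha_k, plus 1 for positivity. *)
have DB k : D k <= M * (kappa_v * alpha k * d k).
  have ak := a_gt0 k.
  have topt : dotv (g (x k)) (u k) + enorm (u k) ^+ 2 / alpha k <=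
      r (x k) - r (x k + (v k + u k)) + Br * enorm (v k).
    apply: tangential_optimality Hr_conv Xopen (Xx k).2 rLip ak _ => t.
    by apply: (Hstep2 k).2; rewrite -scalemxAr (Hstep2 k).1 scaler0.
  have vM := ler_wpM2l (ltW M0) (vB k).
  apply: le_trans vM.
  have gv : dotv (g (x k)) (v k) <= `|Bg| * enorm (v k).
    rewrite (le_trans (dotv_le_enorm _ _))// ler_wpM2r ?enorm_ge0//.
    by rewrite (le_trans (gX _ (Xx k).1))// ler_norm.
  have vv : enorm (v k) ^+ 2 / alpha k <= kappa_v * (BJ * Bc) * enorm (v k).
    rewrite expr2 mulrAC ler_wpM2r ?enorm_ge0// ler_pdivrMr//.
    by rewrite (le_trans (vB k))// mulrAC ler_wpM2r// ?ler_wpM2l// ltW.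
  rewrite /D /s dotvDr sqr_enormD vu mulr0 addr0.
  rewrite -(mulrA (sigma_u + _)) [(_ + _) / alpha k]mulrDl.
  have U0 : 0 <= enorm (u k) ^+ 2 / alpha k by rewrite divr_ge0 ?sqr_ge0// ltW.
  have V0 : 0 <= enorm (v k) ^+ 2 / alpha k by rewrite divr_ge0 ?sqr_ge0// ltW.
  have := enorm_ge0 (v k); rewrite /M; move: topt gv vv U0 V0.
  move: (enorm (v k)) (enorm (u k) ^+ 2 / _) (enorm (v k) ^+ 2 / _) (kappa_v * (BJ * Bc)) => W U V Z.
  move=> topt gv vv U0 V0 W0.
  (* As sigma_u <= 1/2, the weight of |u|^2/alpha is at most 1, the weight with which it appears in
     [topt]. *)
  have : (sigma_u + 2^-1) * (V + U) <= 1 * (V + U) by apply: ler_wpM2r; lra.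
  lra.
(* Chosen so that [rho * d k] times the upper bound on [D k] equals (1 - sigma_c) times the Cauchy
   lower bound on [Delta k]; thus [rho * d k] is below the trial parameter whenever [D k] is
   positive. *)
pose rho := (1 - sigma_c) * kappa / (2 * Bc * M * kappa_v).
have rho0 : 0 < rho by rewrite divr_gt0 ?mulr_gt0//; lra.
have rhoD k : rho * d k * D k <= (1 - sigma_c) * Delta k.
  have d0 : 0 <= rho * d k by rewrite mulr_ge0 ?enorm_ge0// ltW.
  rewrite (le_trans (ler_wpM2l d0 (DB k)))//.
  have -> : rho * d k * (M * (kappa_v * alpha k * d k)) =
      (1 - sigma_c) * ((alpha k * kappa * d k ^+ 2) / (2 * Bc)).
    by rewrite /rho; field; rewrite !gt_eqF.
  rewrite ler_wpM2l//; first by lra.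
  by rewrite ler_pdivrMr ?mulr_gt0// [Delta k * _]mulrC DeltaB.
clearbody rho.
have tau_update k : 0 < prev_tau tau_m1 tau k ->
  [/\ 0 < tau k, tau k <= prev_tau tau_m1 tau k, tau k * D k <= (1 - sigma_c) * Delta k
    & Num.min (prev_tau tau_m1 tau k) ((1 - eps_tau) * (rho * d k)) <= tau k].
  move=> tp0; apply: merit_parameter_update (Hstep3 k) => //.
  - exact: Delta_ge0.
  - by rewrite mulr_ge0 ?enorm_ge0// ltW.
  rewrite -/(s k) -/(D k) => Dk; rewrite mulr_gt0// lt_def enorm_ge0 andbT; apply/eqP => dk.
  by have := DB k; rewrite dk !mulr0; lra.
have tau_gt0 k : 0 < tau k.
  by elim: k => [|k IH]; [have [] := tau_update 0%N Htau_m1|have [] := tau_update k.+1 IH].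
have tauD k : tau k * D k <= (1 - sigma_c) * Delta k.
  by case: k => [|k]; [have [] := tau_update 0%N Htau_m1|have [] := tau_update k.+1 (tau_gt0 k)].

(* Model reduction and acceptance of short steps *)
have Js k : J (x k) *m s k = J (x k) *m v k by rewrite mulmxDr (Hstep2 k).1 addr0.
have dq_ge k : sigma_c * Delta k <= dq k.
  have ak := a_gt0 k.
  (* [D] weights |s|^2/alpha by sigma_u + 1/2, the model only by 1/2; the surplus has a favorable
     sign. *)
  have -> : dq k = - (tau k * D k) + tau k * (sigma_u * (enorm (s k) ^+ 2 / alpha k)) + Delta k.
    rewrite /dq /model_red Js /D /Delta; field; rewrite gt_eqF//.
  have : 0 <= tau k * (sigma_u * (enorm (s k) ^+ 2 / alpha k)).
    rewrite mulr_ge0 ?(ltW (tau_gt0 k))// mulr_ge0 ?divr_ge0 ?sqr_ge0 ?(ltW ak)//; lra.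
  have := tauD k; lra.
(* The Taylor errors total (tau Lg + LJ)|s|^2/2, absorbed by the proximal term tau |s|^2/(2 alpha)
   of the model for such [alpha]. The merit function then drops by at least [dq k], hence by
   [eta * dq k]. *)
have accept k : alpha k * (tau k * Lg + LJ) <= tau k ->
    merit f r c (tau k) (x k + s k) <= merit f r c (tau k) (x k) - eta * dq k.
  have ak := a_gt0 k.
  move=> small.
  have dq0 : 0 <= dq k by rewrite (le_trans _ (dq_ge k))// mulr_ge0//; lra.
  apply: (@le_trans _ _ (merit f r c (tau k) (x k) - dq k)); last by nra.
  have fT := smooth_upper_bound Hf_diff Hf_grad Xconv gLip' (Xx k).1 (Xx k).2.
  have cT := jacobian_taylor_bound Hc_diff Hc_jac Xconv JLip' (Xx k).1 (Xx k).2.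
  rewrite -/(s k) in fT cT; have := ler_wpM2l (ltW (tau_gt0 k)) fT.
  have : (tau k * Lg + LJ) * enorm (s k) ^+ 2 <= tau k * (enorm (s k) ^+ 2 / alpha k).
    by rewrite mulrA ler_pdivlMr// mulrAC ler_wpM2r ?sqr_ge0// mulrC.
  rewrite /merit /dq /model_red.
  have -> : (2 * alpha k)^-1 * enorm (s k) ^+ 2 = 2^-1 * (enorm (s k) ^+ 2 / alpha k).
    by field; rewrite gt_eqF.
  move: cT; move: (enorm (s k) ^+ 2) (enorm (s k) ^+ 2 / alpha k) => S Z; lra.

(* Lower bounds on tau and alpha when [d] stays above [eps] *)
apply: (@subsequence_cvg0 _ _ (fun k => (J (x k))^T *m c (x k))) => eps K eps0; apply: contrapT => far.
have d_ge k : (K <= k)%N -> eps <= d k.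
  by move=> Kk; rewrite leNgt; apply/negP => dk; apply: far; exists k.
pose tau_min := Num.min (tau K) ((1 - eps_tau) * (rho * eps)).
have tau_min0 : 0 < tau_min by rewrite lt_min tau_gt0 !mulr_gt0//; lra.
have tau_ge k : (K <= k)%N -> tau_min <= tau k.
  elim: k => [|k IH]; first by rewrite leqn0 => /eqP K0; rewrite ge_min K0 lexx.
  rewrite leq_eqVlt ltnS => /orP[/eqP <-|Kk]; first by rewrite ge_min lexx.
  have [_ _ _] := tau_update k.+1 (tau_gt0 k); apply: le_trans.
  rewrite le_min IH//= ge_min; apply/orP; right.
  by rewrite !ler_wpM2l ?(ltW rho0)// ?d_ge ?leqW//; lra.
(* Below this threshold alpha_k (Lg + LJ/tau_k) <= 1, which is the condition of [accept] divided by
   tau_k. *)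
pose a_thr := (Lg + LJ / tau_min + 1)^-1.
have a_thr0 : 0 < a_thr.
  by rewrite invr_gt0 ltr_wpDl ?addr_ge0 ?divr_ge0 ?(ltW tau_min0).
have accept_small k : (K <= k)%N -> alpha k <= a_thr ->
    merit f r c (tau k) (x k + s k) <= merit f r c (tau k) (x k) - eta * dq k.
  move=> /tau_ge tk ak; apply: accept.
  have -> : tau k * Lg + LJ = tau k * (Lg + LJ / tau k).
    by field; rewrite gt_eqF.
  rewrite mulrCA ler_piMr ?(ltW (tau_gt0 k))//.
  rewrite -(mulfV (lt0r_neq0 a_thr0)).
  rewrite ler_pM ?(ltW (a_gt0 k)) ?addr_ge0 ?divr_ge0 ?(ltW (tau_gt0 k))//.
  rewrite invrK -addrA lerD2l (@le_trans _ _ (LJ / tau_min)) ?lerDl//.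
  by rewrite ler_wpM2l// lef_pV2 ?posrE.
(* A rejection requires alpha_k >= [a_thr], and it shrinks alpha_k by the factor [xi] only. *)
pose a_min := Num.min (alpha K) (xi * a_thr).
have a_min0 : 0 < a_min by rewrite lt_min a_gt0 mulr_gt0//; lra.
have a_ge k : (K <= k)%N -> a_min <= alpha k.
  elim: k => [|k IH]; first by rewrite leqn0 => /eqP K0; rewrite ge_min K0 lexx.
  rewrite leq_eqVlt ltnS => /orP[/eqP <-|Kk]; first by rewrite ge_min lexx.
  have := step4 k; case: ifP => [_ [_ ->]|rej [_ ->]]; first exact: IH.
  rewrite ge_min; apply/orP; right; rewrite ler_wpM2l//; first by lra.
  by rewrite leNgt; apply/negP => /ltW /(accept_small k Kk); rewrite rej.
clearbody a_min.

(* Uniform decrease of a nonnegative potential *)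
pose E k := tau k * (f (x k) - flow + r (x k)) + enorm (c (x k)) + alpha k.
have fr_ge0 k : 0 <= f (x k) - flow + r (x k).
  by rewrite addr_ge0// subr_ge0 fX//; have [] := Xx k.
have E0 k : 0 <= E k.
  by rewrite /E !addr_ge0 ?enorm_ge0 ?mulr_ge0// ltW.
(* The fraction [eta] of the lower bound on [dq k] given by [dq_ge] and [DeltaB] with alpha_k >=
   [a_min] and d_k >= [eps]. *)
pose drop := eta * (sigma_c * (a_min * kappa * eps ^+ 2 / (2 * Bc))).
have drop0 : 0 < drop.
  by rewrite !(mulr_gt0, invr_gt0, exprn_gt0)//; lra.
pose delta := Num.min drop ((1 - xi) * a_min).
have delta0 : 0 < delta by rewrite lt_min drop0 mulr_gt0//; lra.
apply: (no_uniform_decrease (E := E) (d := delta) (K := K)) => // k Kk.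
have tauS : tau k.+1 <= tau k by have [] := tau_update k.+1 (tau_gt0 k).
(* Subtracting [flow] makes the factor of tau nonnegative, so tau_{k+1} may be raised to tau_k and
   one merit function serves both iterates. *)
apply: (@le_trans _ _ (tau k * (f (x k.+1) - flow + r (x k.+1)) + enorm (c (x k.+1)) + alpha k.+1)).
  by rewrite !lerD2r ler_wpM2r.
have := step4 k; case: ifP => [acc [-> ->]|rej [-> ->]].
  have delta_drop : delta <= drop by rewrite ge_min lexx.
  have : drop <= eta * dq k.
    rewrite ler_wpM2l//; first by lra.
    rewrite (le_trans _ (dq_ge k))// ler_wpM2l//; first by lra.
    rewrite ler_pdivrMr ?mulr_gt0// [Delta k * _]mulrC (le_trans _ (DeltaB k))//.
    apply: ler_pM; rewrite ?sqr_ge0//.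
    - by rewrite mulr_ge0 ?(ltW a_min0) ?(ltW kappa_gt0).
    - by rewrite ler_wpM2r ?a_ge// ltW.
    - by rewrite ler_pXn2r ?nnegrE ?enorm_ge0 ?d_ge ?(ltW eps0).
  move: acc; rewrite /merit /E; lra.
have delta_rej : delta <= (1 - xi) * a_min by rewrite ge_min lexx orbT.
have : (1 - xi) * a_min <= (1 - xi) * alpha k.
  by rewrite ler_wpM2l ?a_ge//; lra.
rewrite /E; lra.
Qed.
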